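(* For all natural numbers $m,k,r$ with $k\ge 1$ there exists a natural number $n$ such that for every coloring $c:\mathrm{FIN}_k(n)\to\{0,1,\ldots,r-1\}$ there exists a block sequence $(f_i)_{i<m}$ of length $m$ of elements of $\mathrm{FIN}_k(n)$ such that $c$ is constant on the combinatorial space $\langle f_i\rangle_{i<m}$ generated by $(f_i)_{i<m}$.
   Context: $\mathbb{N}$ is the set of natural numbers starting at $0$. For $k\ge 1$, $\mathrm{FIN}_k$ is the set of all functions $f:\mathbb{N}\to\{0,1,\ldots,k\}$ that attain the maximum value $k$ and whose support $\mathrm{supp}(f)=\{n\in\mathbb{N}: f(n)\neq 0\}$ is finite. For $n\in\mathbb{N}$, $\mathrm{FIN}_k(n)=\{f\in\mathrm{FIN}_k:\max(\mathrm{supp}(f))<n\}$. For $f,g\in\mathrm{FIN}_k$ write $f<g$ if $\max(\mathrm{supp}(f))<\min(\mathrm{supp}(g))$. A block sequence of length $m$ is a sequence $(f_i)_{i<m}$ (indexed by $0\le i<m$) of elements of $\mathrm{FIN}_k$ with $f_i<f_j$ for all $i<j<m$. The tetris operation $T$ is defined pointwise by $(Tf)(x)=\max\{0,f(x)-1\}$, and $T^l$ is its $l$-th iterate ($T^0$ is the identity); sums of functions are pointwise. The combinatorial space $\langle f_i\rangle_{i<m}$ generated by a block sequence $(f_i)_{i<m}$ is the set of all functions of the form $T^{l_0}(f_{i_0})+\cdots+T^{l_{p-1}}(f_{i_{p-1}})$ with $p\ge 1$, $i_0<\cdots<i_{p-1}<m$, $l_0,\ldots,l_{p-1}\in\mathbb{N}$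 and $\min\{l_0,\ldots,l_{p-1}\}=0$. *)

(* Defs.v *)
From mathcomp Require Import all_boot.
From mathcomp Require Import mathcomp_extra boolp classical_sets functions cardinality.

Set Implicit Arguments.
Unset Strict Implicit.
Unset Printing Implicit Defensive.

Local Open Scope classical_set_scope.

Definition supp (f : nat -> nat) : set nat := [set x | f x != 0].

Definition FIN (k : nat) : set (nat -> nat) :=
  [set f | [/\ forall x, f x <= k, exists x, f x = k & finite_set (supp f)]].

(* For k >= 1 supports are nonempty, so bounding every element of the support
   is the same as bounding its maximum. *)
Definition FIN_below (k n : nat) : set (nat -> nat) :=
  [set f | FIN k f /\ forall x, supp f x -> x < n].

Definition block_lt (f g : nat -> nat) : Prop :=
  forall x y, supp f x -> supp g y -> x < y.

Definition block_seq (m : nat) (f : 'I_m -> nat -> nat) : Prop :=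
  forall i j : 'I_m, i < j -> block_lt (f i) (f j).

(* Truncated subtraction. *)
Definition tetris (f : nat -> nat) : nat -> nat := fun x => f x - 1.

(* A minimum of natural numbers is 0 iff one of them is 0. *)
Definition comb_space (m : nat) (f : 'I_m -> nat -> nat) : set (nat -> nat) :=
  [set g | exists (p : nat) (i : 'I_p -> 'I_m) (l : 'I_p -> nat),
     [/\ 0 < p,
         forall a b : 'I_p, a < b -> i a < i b,
         exists a, l a = 0
       & g = fun x => \sum_(a < p) iter (l a) tetris (f (i a)) x]].

Lemma iter_tetrisE l f x : iter l tetris f x = f x - l.
Proof.
by elim: l => [|l IH] /=; rewrite ?subn0 // /tetris IH -subnDA addn1.
Qed.

(* Hence a coloring of FIN_below k n colors every point of the space. *)
Lemma comb_space_sub (m k n : nat) (f : 'I_m -> nat -> nat) :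
  0 < k -> (forall i, FIN_below k n (f i)) -> block_seq f ->
  comb_space f `<=` FIN_below k n.
Proof.
move=> k0 fF fB _ [p [i [l [_ imono [a0 la0] ->]]]].
have iF a : FIN_below k n (f (i a)) by exact: fF.
have zero x a b : f (i a) x != 0 -> b != a -> f (i b) x = 0.
  move=> fa ba; apply/eqP; apply: contraT => fb.
  have [ab|ba'|/val_inj E] := ltngtP b a; last by rewrite E eqxx in ba.
  - by have := fB _ _ (imono _ _ ab) x x fb fa; rewrite ltnn.
  - by have := fB _ _ (imono _ _ ba') x x fa fb; rewrite ltnn.
have sumE x a : f (i a) x != 0 ->
    \sum_(b < p) iter (l b) tetris (f (i b)) x = f (i a) x - l a.
  move=> fa; rewrite (bigD1 a) //= iter_tetrisE big1 ?addn0 // => b ba.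
  by rewrite iter_tetrisE (zero x a b).
have sum0 x : (forall a, f (i a) x = 0) ->
    \sum_(b < p) iter (l b) tetris (f (i b)) x = 0.
  by move=> H; rewrite big1 // => b _; rewrite iter_tetrisE H.
have dich x : (exists a, f (i a) x != 0) \/ forall a, f (i a) x = 0.
  have [/existsP H|/existsPn H] := boolP [exists a, f (i a) x != 0]; [by left|right].
  by move=> a; apply/eqP; have := H a; rewrite negbK.
have bound x : supp (fun x => \sum_(b < p) iter (l b) tetris (f (i b)) x) x -> x < n.
  rewrite /supp /=; have [[a fa] _|/sum0 ->] := dich x; last by rewrite eqxx.
  by case: (iF a) => _; apply.
split=> //; split.
- move=> x; have [[a fa]|/sum0 ->//] := dich x.
  rewrite (sumE _ _ fa); apply: leq_trans (leq_subr _ _) _.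
  by case: (iF a) => -[].
- case: (iF a0) => -[_ [x fx] _] _; exists x.
  by rewrite (sumE x a0) ?la0 ?subn0 ?fx // -lt0n.
- by apply: sub_finite_set (finite_II n) => x /bound.
Qed.

(* Main.v *)
Require Import Defs.
From mathcomp Require Import all_boot.
From mathcomp Require Import mathcomp_extra boolp classical_sets functions cardinality.
From mathcomp Require Import zify.

(** Elements of [FIN_k] are words with letters at most [k] in which [k] occurs,
    sums of blocks are concatenations, and a member of a combinatorial space is
    a substitution instance [sub k F h], where the letter [k - l] of [h] stands
    for [T^l].

    The theorem for [k] implies its Milliken-Taylor version for [d]-tuples by
    making the colour of a tuple depend only on its first entry.  The
    Milliken-Taylor theorem for [k] gives a sequence [W] such that the colour of
    [v0 + u1 + v1 + ... + up + vp], with the [vi] in the space of [W] and the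
    [ui] lifts to level [k + 1] of members of it, depends only on [p].  The
    pyramids [w0 + lift w1 + w2] built from consecutive triples of [W] satisfy
    [T (w0 + lift w1 + w2) = T w0 + w1 + T w2], so every pyramid with at least
    one [T] applied is absorbed in the neighbouring [vi], and the colour of a
    member of their space depends only on the number of pyramids used with
    [l = 0].  Folkman's theorem on subset sums then makes it constant.  At
    [k = 0] the statement is the pigeonhole principle. *)

Set Implicit Arguments.
Unset Strict Implicit.
Unset Printing Implicit Defensive.

(** * Words and substitution *)

(* [T^(k - a)] on words: [act k k] is the identity, [act k 0] kills words over {0..k}. *)
Definition act (k a : nat) (w : seq nat) := [seq x - (k - a) | x <- w].

(** On words over {0..k} a letter 0 turns its block into zeros instead of deleting it, so blocks
    never move. *)
Fixpoint sub (k : nat) (F : seq (seq nat)) (h : seq nat) : seq nat :=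
  match F, h with
  | f :: F', a :: h' => act k a f ++ sub k F' h'
  | _, _ => [::]
  end.

(* The words of [H] are substituted into consecutive segments of [F], so that [subs k F H]
   is a block sequence in the space of [F]. *)
Fixpoint subs (k : nat) (F H : seq (seq nat)) : seq (seq nat) :=
  if H is h :: H' then sub k F h :: subs k (drop (size h) F) H' else [::].

Definition word (k : nat) (w : seq nat) := all (geq k) w.

Definition good (k : nat) (w : seq nat) := word k w && (k \in w).

Lemma good_word k w : good k w -> word k w.
Proof. by case/andP. Qed.

Lemma good_words k F : all (good k) F -> all (word k) F.
Proof. by apply: sub_all => w; apply: good_word. Qed.

Lemma all_drop (T : Type) (p : pred T) n s : all p s -> all p (drop n s).
Proof. by rewrite -{1}(cat_take_drop n s) all_cat => /andP[]. Qed.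

Lemma size_act k a w : size (act k a w) = size w.
Proof. exact: size_map. Qed.

Lemma word_act k a w : word k w -> word k (act k a w).
Proof.
move=> /allP W; rewrite /word all_map; apply/allP => x /W /= xk; lia.
Qed.

Lemma act_id k w : act k k w = w.
Proof. by rewrite /act subnn -[RHS]map_id; apply: eq_map => x; rewrite subn0. Qed.

Lemma sub_nil k F : sub k F [::] = [::].
Proof. by case: F. Qed.

Lemma sub_cat k F h h' : sub k F (h ++ h') = sub k F h ++ sub k (drop (size h) F) h'.
Proof.
by elim: F h => [|f F IH] [|a h] //=; rewrite ?drop0 // IH catA.
Qed.

Lemma size_sub k F h : size (sub k F h) = size (flatten (take (size h) F)).
Proof.
by elim: F h => [|f F IH] [|a h] //=; rewrite !size_cat size_act IH.
Qed.

(** Exponents of [T] add up, and capping them at [k] changes nothing on letters at most [k]. *)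
Lemma act_sub k a F h : all (word k) F -> word k h ->
  act k a (sub k F h) = sub k F (act k a h).
Proof.
elim: F h => [|f F IH] [|b h] //= /andP[Wf WF] /andP[bk Wh].
rewrite /act map_cat -/(act k a (sub k F h)) IH //; congr (_ ++ _).
rewrite -map_comp; apply/eq_in_map => x /(allP Wf) /= xk; lia.
Qed.

Lemma word_sub k F h : all (word k) F -> word k (sub k F h).
Proof.
elim: F h => [|f F IH] [|b h] //= /andP[Wf WF].
by rewrite /word all_cat -!/(word _ _) IH // word_act.
Qed.

Lemma good_sub k F h : all (good k) F -> size h <= size F -> good k h -> good k (sub k F h).
Proof.
move=> GF sz /andP[_ kh]; rewrite /good word_sub ?good_words //=.
elim: F h GF sz kh => [|f F IH] [|b h] //= /andP[Gf GF] sz.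
rewrite inE mem_cat => /orP[/eqP <-|kh]; last by rewrite IH ?orbT.
by rewrite act_id; case/andP: Gf => _ ->.
Qed.

Lemma flatten_subs k F H : flatten (subs k F H) = sub k F (flatten H).
Proof. by elim: H F => [|h H IH] F /=; rewrite ?sub_nil // IH sub_cat. Qed.

Lemma size_subs k F H : size (subs k F H) = size H.
Proof. by elim: H F => //= h H IH F; rewrite IH. Qed.

Lemma size_flatten_subs k F H : size (flatten (subs k F H)) <= size (flatten F).
Proof.
rewrite flatten_subs size_sub -[in leqRHS](cat_take_drop (size (flatten H)) F).
by rewrite flatten_cat size_cat leq_addr.
Qed.

Lemma good_subs k F H : all (good k) F -> all (good k) H ->
  size (flatten H) <= size F -> all (good k) (subs k F H).
Proof.
elim: H F => //= h H IH F GF /andP[Gh GH]; rewrite size_cat => sz.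
rewrite good_sub ?IH ?all_drop ?size_drop //; lia.
Qed.

Lemma subs_cat k F H H' :
  subs k F (H ++ H') = subs k F H ++ subs k (drop (size (flatten H)) F) H'.
Proof.
elim: H F => [|h H IH] F /=; rewrite ?drop0 // IH drop_drop size_cat.
by rewrite [size h + _]addnC.
Qed.

Lemma drop_subs k F H j :
  drop j (subs k F H) = subs k (drop (size (flatten (take j H))) F) (drop j H).
Proof.
elim: H F j => [|h H IH] F [|j] //=; rewrite ?drop0 // IH drop_drop size_cat.
by rewrite [size h + _]addnC.
Qed.

(** Associativity of substitution: passing to a block sequence inside the space of [F] never leaves
    that space. *)
Lemma sub_subs k F H h : all (word k) F -> all (word k) H ->
  sub k (subs k F H) h = sub k F (sub k H h).
Proof.
elim: H F h => [|f H IH] F [|a h] //= WF; rewrite ?sub_nil // => /andP[Wf WH].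
by rewrite sub_cat act_sub // size_act IH // all_drop.
Qed.

Lemma subs_subs k F H K : all (word k) F -> all (word k) H ->
  subs k (subs k F H) K = subs k F (subs k H K).
Proof.
elim: K F H => //= h K IH F H WF WH.
by rewrite sub_subs // drop_subs size_sub IH ?all_drop.
Qed.

(** * Pigeonhole principle and Folkman's theorem *)

Lemma pigeonhole (T : Type) (C : finType) (f : T -> C) m s :
  C -> m * #|C| <= size s -> exists x, m <= count (fun y => f y == x) s.
Proof.
move=> x0 sz; apply/existsP; apply: contraLR sz => /existsPn small.
have -> : size s = \sum_(x : C) count (fun y => f y == x) s.
  elim: s {small} => [|y s IH] /=; first by rewrite big1.
  rewrite big_split /= -IH (bigD1 (f y)) //= eqxx big1 // => x /negPf.
  by rewrite eq_sym => ->.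
rewrite -ltnNge mulnC -sum_nat_const (bigD1 x0) //= [ltnRHS](bigD1 x0) //=.
apply: (@leq_add _.+1); first by rewrite ltnNge small.
by apply: leq_sum => x _; rewrite ltnW // ltnNge small.
Qed.

Definition FS (b : seq nat) (x : nat) := exists2 s, subseq s b & sumn s = x.

Lemma FS_cat b1 b2 x1 x2 : FS b1 x1 -> FS b2 x2 -> FS (b1 ++ b2) (x1 + x2).
Proof.
by move=> [s1 S1 <-] [s2 S2 <-]; exists (s1 ++ s2); rewrite ?cat_subseq ?sumn_cat.
Qed.

Lemma FS_cons a b x : FS (a :: b) x -> FS b x \/ exists2 y, FS b y & x = a + y.
Proof.
move=> [[|c s] /= sb <-]; first by left; exists [::]; rewrite ?sub0seq.
move: sb; case: eqP => [-> sb|_ sb]; last by left; exists (c :: s).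
by right; exists (sumn s) => //; exists s.
Qed.

Lemma FS0 b : FS b 0.
Proof. by exists [::]; rewrite ?sub0seq. Qed.

Definition pos (b : seq nat) := all (leq 1) b.

(* [a] and the first element of [b'] are found by pigeonhole among the partial sums of a
   tail of [b], after the induction hypothesis has handled all these shifts at once. *)
Lemma hilbert_cube j (C : finType) : exists n, forall b (f : nat -> C),
  pos b -> size b = n ->
  exists a b', [/\ 0 < a, pos b', size b' = j,
    forall x, FS b' x -> FS b x /\ FS b (a + x)
  & forall x, FS b' x -> f (a + x) = f a].
Proof.
elim: j C => [|j IH] C.
  exists 1 => -[//|a []//] f; rewrite /pos /= andbT => a0 _.
  exists a, [::]; split=> // x [[|//] _ <-] /=; rewrite addn0 //.
  by split; [exact: FS0|exists [:: a]; rewrite /= ?eqxx ?addn0].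
have [n nP] := IH {ffun 'I_#|C|.+1 -> C}.
(* The tail of length [#|C|] has [#|C| + 1] partial sums, one more than there are colours. *)
exists (n + #|C|) => b f Pb sb.
pose b1 := take n b; pose b2 := drop n b.
have sb1 : size b1 = n by rewrite size_take sb; case: ltngtP; lia.
have sb2 : size b2 = #|C| by rewrite size_drop sb; lia.
have bE : b = b1 ++ b2 by rewrite cat_take_drop.
have [Pb1 Pb2] : pos b1 /\ pos b2 by apply/andP; rewrite -all_cat -bE.
pose P i := sumn (take i b2).
have [a [b' [a0 Pb' sb' b'S fa]]] :=
  nP b1 (fun x => [ffun i : 'I_#|C|.+1 => f (x + P i)]) Pb1 sb1.
have {}fa x i : i <= #|C| -> FS b' x -> f (a + x + P i) = f (a + P i).
  by rewrite -ltnS => iC /fa /ffunP /(_ (Ordinal iC)); rewrite !ffunE.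
have [i [i' [ii' i'C fii']]] : exists i i', [/\ i < i', i' <= #|C| & f (a + P i) = f (a + P i')].
  have /injectivePn[i [i' ii' e]] : ~~ injectiveb (fun i : 'I_#|C|.+1 => f (a + P i)).
    by apply/injectiveP => /leq_card; rewrite card_ord ltnn.
  have [lt|lt|/val_inj E] := ltngtP i i'; last by rewrite E eqxx in ii'.
    by exists i, i'; split; [|rewrite -ltnS; exact: ltn_ord|exact: e].
  by exists i', i; split; [|rewrite -ltnS; exact: ltn_ord|exact: esym].
(* Adding [sumn D] moves [a + P i] to [a + P i'], of the same colour, so [sumn D] can join the
   cube. *)
pose D := drop i (take i' b2).
have PE : P i' = P i + sumn D.
  rewrite /P -sumn_cat; congr sumn.
  by rewrite -[LHS](cat_take_drop i) take_takel ?(ltnW ii').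
have D0 : 0 < sumn D.
  have : pos D.
    apply: all_drop; move: Pb2; rewrite -{1}(cat_take_drop i' b2).
    by rewrite /pos all_cat => /andP[].
  have : size D = i' - i by rewrite size_drop size_takel // sb2.
  case: D {PE} => [|d D] /=; first lia.
  by move=> _ /andP[]; lia.
have FD : FS b2 (sumn D).
  by exists D => //; apply: subseq_trans (drop_subseq _ _) (take_subseq _ _).
have FP l : FS b2 (P l) by exists (take l b2) => //; apply: take_subseq.
exists (a + P i), (sumn D :: b'); split=> //=.
- lia.
- by rewrite D0.
- by rewrite sb'.
- move=> x /FS_cons[|[y]] /b'S [F1 F2] => [|->]; rewrite bE; split.
  + by rewrite -[x]addn0; apply: FS_cat => //; apply: FS0.
  + by rewrite addnAC; apply: FS_cat.
  + by rewrite addnC; apply: FS_cat.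
  + by rewrite (_ : _ + _ = a + y + P i') ?PE; [apply: FS_cat; rewrite // -PE|lia].
- move=> x /FS_cons[|[y]] Fx => [|->].
  + rewrite addnAC fa //; lia.
  + rewrite (_ : _ + _ = a + y + P i') ?PE; last lia.
    by rewrite -PE fa.
Qed.

(** Iterates [hilbert_cube]: [a] becomes the first element, and the search continues inside [b'],
    whose subset sums do not change the colour when added to [a]. *)
Lemma folkman_first N (C : finType) : exists M, forall b (f : nat -> C),
  pos b -> size b = M ->
  exists p, [/\ pos p, size p = N, forall x, FS p x -> FS b x
    & forall a s, subseq (a :: s) p -> f (a + sumn s) = f a].
Proof.
elim: N => [|N [M IH]].
  exists 0 => -[|//] f _ _; exists [::]; split=> //.
have [n nP] := hilbert_cube M C.
exists n => b f Pb sb; have [a [b' [a0 Pb' sb' b'S fa]]] := nP b f Pb sb.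
have [p [Pp sp pS fp]] := IH b' f Pb' sb'.
exists (a :: p); split=> /=; rewrite ?a0 ?sp //.
- by move=> x /FS_cons[|[y]] /pS /b'S [] // ? ? ->.
- move=> c s; case: eqP => [-> sp'|_ cs]; last exact: fp.
  by apply: fa; apply: pS; exists s.
Qed.

Lemma folkman m (C : finType) : exists M, forall f : nat -> C,
  exists p x, [/\ pos p, size p = m, sumn p <= M
    & forall s, subseq s p -> 0 < sumn s -> f (sumn s) = x].
Proof.
have [M MP] := folkman_first (m * #|C|) C.
(* Starting from [M] ones bounds [sumn p] by [M]. Pigeonhole on the colours of single elements then
   suffices. *)
exists M => f; have [||p [Pp sp pS fp]] := MP (nseq M 1) f; rewrite ?size_nseq //.
  by rewrite /pos all_nseq orbT.
have [|x xm] := @pigeonhole _ _ f m p (f 0); first by rewrite sp.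
set q := [seq y <- p | f y == x].
have qp : subseq (take m q) p by apply: subseq_trans (take_subseq _ _) (filter_subseq _ _).
exists (take m q), x; split.
- by apply/allP => y /(mem_subseq qp)/(allP Pp).
- by rewrite size_takel // size_filter.
- have [|s sM <-] := pS (sumn (take m q)); first by exists (take m q).
  have /all_pred1P -> : all (pred1 1) s.
    by apply/allP => y /(mem_subseq sM); rewrite mem_nseq => /andP[].
  by rewrite sumn_nseq mul1n; have := size_subseq sM; rewrite size_nseq.
- move=> [//|a s] sq _; rewrite /= fp ?(subseq_trans sq) //.
  have /(mem_subseq (take_subseq _ _)) : a \in take m q.
    by apply: (mem_subseq sq); rewrite mem_head.
  by rewrite mem_filter => /andP[/eqP].
Qed.

(** * Word forms of the theorems of Gowers and Milliken-Taylor *)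

Definition base (k m n : nat) (F : seq (seq nat)) :=
  [/\ size F = m, size (flatten F) <= n & all (good k) F].

Definition tuple_in (k d m : nat) (H : seq (seq nat)) :=
  [/\ size H = d, all (good k) H & size (flatten H) <= m].

Definition gowers (k : nat) := forall (C : finType) m, exists n,
  forall c : seq nat -> C, exists F, base k m n F /\
    forall h h', good k h -> good k h' -> size h <= m -> size h' <= m ->
      c (sub k F h) = c (sub k F h').

Definition milliken (k d : nat) := forall (C : finType) m, exists n,
  forall c : seq (seq nat) -> C, exists F, base k m n F /\
    forall H H', tuple_in k d m H -> tuple_in k d m H' ->
      c (subs k F H) = c (subs k F H').

Lemma subs_base k m n p F G : base k m n F -> base k p m G -> base k p n (subs k F G).
Proof.
move=> [sF fF GF] [sG fG GG]; split; first by rewrite size_subs.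
  exact: leq_trans (size_flatten_subs _ _ _) fF.
by rewrite good_subs // sF.
Qed.

Lemma subs_tuple_in k d m n F H : base k m n F -> tuple_in k d m H ->
  tuple_in k d n (subs k F H).
Proof.
move=> [sF fF GF] [sH GH fH]; split; first by rewrite size_subs.
  by rewrite good_subs // sF.
exact: leq_trans (size_flatten_subs _ _ _) fF.
Qed.

Lemma good_nseq k : good k [:: k].
Proof. by rewrite /good /word /= leqnn mem_head. Qed.

Lemma tuple_in_nseq k d : tuple_in k d d (nseq d [:: k]).
Proof.
split; rewrite ?size_nseq ?all_nseq ?good_nseq ?orbT //.
by elim: d.
Qed.

(** * Level 0 *)

Definition gaps (a : nat) (t : seq nat) := pairmap (fun x y => nseq (y - x) 0) a t.

(** At level 0 a good word is a nonempty run of zeros, determined by its length; the lengths of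
    consecutive gaps telescope. *)
Lemma sub_gaps a t h : path ltn a t -> word 0 h -> size h <= size t ->
  sub 0 (gaps a t) h = nseq (last a (take (size h) t) - a) 0.
Proof.
elim: t a h => [|l t IH] a [|b h] //=; rewrite ?subnn //.
move=> /andP[al pt] /andP[b0 h0] sh; rewrite -/(gaps l t) IH //.
have -> : b = 0 by move: b0; rewrite /= leqn0 => /eqP.
have : l <= last l (take (size h) t).
  have := pt; rewrite -{1}(cat_take_drop (size h) t) cat_path => /andP[].
  move/(sub_path ltnW)/(order_path_min leq_trans)/allP => A _.
  by have := mem_last l (take (size h) t); rewrite inE => /orP[/eqP ->|/A].
by rewrite act_id -nseqD => ll; congr nseq; lia.
Qed.

Lemma base_gaps n t : path ltn 0 t -> last 0 t <= n -> base 0 (size t) n (gaps 0 t).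
Proof.
move=> pt tn; split; first by rewrite size_pairmap.
  have := @sub_gaps 0 t (nseq (size t) 0) pt; rewrite /word all_nseq orbT size_nseq leqnn.
  move=> /(_ isT isT) /(congr1 size); rewrite size_sub !size_nseq !take_oversize ?size_pairmap //.
  by move=> ->; rewrite subn0.
suff G a : path ltn a t -> all (good 0) (gaps a t) by exact: G.
elim: t a {pt tn} => //= l t IH a /andP[al /IH ->]; rewrite andbT.
by rewrite /good /word all_nseq mem_nseq subn_gt0 al orbT.
Qed.

Lemma gowers0 : gowers 0.
Proof.
move=> C m; exists (m * #|C|) => c.
have [||x xm] := @pigeonhole _ _ (fun l => c (nseq l 0)) m (iota 1 (m * #|C|)).
- exact: c [::].
- by rewrite size_iota.
set s := [seq l <- iota 1 (m * #|C|) | c (nseq l 0) == x].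
have ps : path ltn 0 (take m s).
  suff : path ltn 0 s by rewrite -{1}(cat_take_drop m s) cat_path => /andP[].
  have : subseq (0 :: s) (iota 0 (m * #|C|).+1) by rewrite /=; apply: filter_subseq.
  by move/(subseq_sorted ltn_trans)/(_ (iota_ltn_sorted _ _)).
have sz : size (take m s) = m by rewrite size_takel // size_filter.
have sP l : l \in take m s -> l <= m * #|C| /\ c (nseq l 0) = x.
  by move/mem_take; rewrite mem_filter mem_iota => /andP[/eqP ? ?]; split; first lia.
move: (take m s) ps sz sP => t pt st tP.
exists (gaps 0 t); rewrite -st; split.
  apply: base_gaps => //; rewrite st; have := mem_last 0 t.
  by rewrite inE => /orP[/eqP -> //|/tP[]].
suff E h : good 0 h -> size h <= size t -> c (sub 0 (gaps 0 t) h) = x.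
  by move=> h h' gh gh' sh sh'; rewrite !E.
case: h => [|b h] gh sh; first by rewrite /good andbF in gh.
rewrite sub_gaps ?good_word // subn0; case: t sh tP {pt st} => //= l t _ tP.
by have [] // := tP (last l (take (size h) t)); rewrite inE; have := mem_last l (take (size h) t);
  rewrite inE => /orP[->//|/mem_take ->]; rewrite orbT.
Qed.

(** * From single words to tuples at a fixed level *)

Lemma milliken0 k : milliken k 0.
Proof.
move=> C m; exists m => c; exists (nseq m [:: k]); split.
  by case: (tuple_in_nseq k m).
by move=> H H' [/size0nil -> _ _] [/size0nil -> _ _].
Qed.

(* [u] need not contain [k], which lets the induction on [m] peel off its letters. *)
Definition stable (k d : nat) := forall (C : finType) m, exists n,
  forall c : seq nat -> seq (seq nat) -> C, exists F, base k m n F /\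
    forall u H H', word k u -> tuple_in k d (m - size u) H -> tuple_in k d (m - size u) H' ->
      c (sub k F u) (subs k (drop (size u) F) H) =
      c (sub k F u) (subs k (drop (size u) F) H').

(** Induction on [m]: [milliken] settles the empty [u]; any other [u] begins with an image of the
    first block [g], and the induction hypothesis treats all [k + 1] images at once. *)
Lemma milliken_stable k d : milliken k d -> stable k d.
Proof.
move=> Md C m; elim: m C => [|m IH] C.
  exists 0 => c; exists [::]; split=> // u H H' _; rewrite sub0n.
  have nil K : tuple_in k d 0 K -> K = [::].
    by case: K => [|[|x w] K] [] //= _ /andP[]; rewrite /good andbF.
  by move=> /nil -> /nil ->.
have [n1 n1P] := IH {ffun 'I_k.+1 -> C}.
have [n2 n2P] := Md C n1.+1.
exists n2 => c.
have [G [bG GP]] := n2P (c [::]).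
have [sG fG gG] := bG.
case: G => [//|g G] in bG GP sG fG gG *.
have [F [bF FP]] := n1P (fun u t => [ffun a : 'I_k.+1 =>
  c (act k a g ++ sub k G u) (subs k (drop (size u) G) t)]).
have [sF fF gF] := bF.
have bF' : base k m.+1 n1.+1 ([:: k] :: F) by split=> //=; rewrite ?sF ?gF ?good_nseq.
have gF' : all (good k) ([:: k] :: F) by case: bF'.
have [Wg WG] : word k g /\ all (word k) G by apply/andP; exact: good_words gG.
have subsE : subs k (g :: G) ([:: k] :: F) = g :: subs k G F.
  by rewrite /= sub_nil cats0 act_id drop0.
exists (g :: subs k G F); rewrite -subsE; split; first exact: subs_base bG bF'.
move=> [|a u] H H' Wu tH tH'.
  rewrite !sub_nil !drop0 !subs_subs ?(good_words gG) ?(good_words gF') //.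
  by apply: GP; apply: subs_tuple_in bF' _.
have {Wu} /andP[ak Wu] : (a <= k) && word k u := Wu.
rewrite subsE /= sub_subs ?(good_words gF) // drop_subs -(size_sub k).
rewrite !subs_subs ?all_drop ?(good_words gF) //.
by move: (FP u H H' Wu tH tH') => /ffunP /(_ (Ordinal (ak : a < k.+1))); rewrite !ffunE.
Qed.

Lemma milliken_succ k d : gowers k -> stable k d -> milliken k d.+1.
Proof.
move=> G S C m.
(* [N] blocks carry [F1]; the other [d] leave room behind the first entry for the reference tuple
   [nseq d [:: k]]. *)
have [N NP] := G C m; have [n nP] := S C (N + d); exists n => c.
have [F [bF FP]] := nP (fun u t => c (u :: t)).
pose e u := c (sub k F u :: subs k (drop (size u) F) (nseq d [:: k])).
have [F1 [bF1 F1P]] := NP e.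
have [sF fF gF] := bF; have [sF1 fF1 gF1] := bF1.
exists (subs k F F1); split.
  by apply: subs_base bF _; split=> //; apply: leq_trans fF1 (leq_addr _ _).
suff E H : tuple_in k d.+1 m H -> c (subs k (subs k F F1) H) = e (sub k F1 (head [::] H)) /\
    good k (head [::] H) /\ size (head [::] H) <= m.
  by move=> H H' /E[-> [? ?]] /E[-> [? ?]]; apply: F1P.
case: H => [[]//|h H] [/= [sH] /andP[gh gH]]; rewrite size_cat => fH.
split; last by split=> //; lia.
have WF := good_words gF; have WF1 := good_words gF1.
rewrite sub_subs // drop_subs subs_subs ?all_drop // -(size_sub k).
have fE : size (sub k F1 h) + size (flatten (subs k (drop (size h) F1) H)) <= N.
  by have := size_flatten_subs k F1 (h :: H); rewrite /= size_cat => /leq_trans; apply.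
apply: FP; first by rewrite word_sub.
- split; rewrite ?size_subs ?good_subs ?all_drop //; last lia.
  by rewrite size_drop sF1; lia.
- by have [? ? ?] := tuple_in_nseq k d; split=> //; lia.
Qed.

Lemma gowers_milliken k d : gowers k -> milliken k d.
Proof.
move=> G; elim: d => [|d Md]; first exact: milliken0.
exact: milliken_succ G (milliken_stable Md).
Qed.

(** * Pyramids: from level [k] to level [k + 1] *)

(* [map S] raises the zeros of a word as well; it is still a right inverse of [T]. *)
Fixpoint lift_odd (b : bool) (t : seq (seq nat)) : seq (seq nat) :=
  if t is v :: t' then (if b then map S v else v) :: lift_odd (~~ b) t' else [::].

Fixpoint pyramids (n : nat) (W : seq (seq nat)) : seq (seq nat) :=
  match n, W with
  | n'.+1, w0 :: w1 :: w2 :: W' => (w0 ++ map S w1 ++ w2) :: pyramids n' W'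
  | _, _ => [::]
  end.

(* Level-[k] words of the tuple (v0, u1, v1, ..., up, vp) for the member [h] of the space of
   pyramids; [v] accumulates the current [vi], and [a.-1] is truncated to 0 at [a = 0], where
   the whole pyramid vanishes. *)
Fixpoint segments (k : nat) (v h : seq nat) : seq (seq nat) :=
  if h is a :: h' then
    if a == k.+1 then (v ++ [:: k]) :: [:: k] :: segments k [:: k] h'
    else segments k (v ++ [:: a.-1; a; a.-1]) h'
  else [:: v].

Lemma size_segments k v h : size (segments k v h) = (2 * count_mem k.+1 h).+1.
Proof. by elim: h v => //= a h IH v; case: eqP => _ /=; rewrite IH; lia. Qed.

Lemma size_flatten_segments k v h :
  size (flatten (segments k v h)) = size v + 3 * size h.
Proof.
elim: h v => [|a h IH] v /=; first by rewrite cats0 muln0 addn0.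
by case: eqP => _ /=; rewrite ?size_cat /= IH ?size_cat /=; lia.
Qed.

(** A full pyramid ends one segment and opens the next with a letter [k], for its [w0] and [w2];
    only without full pyramids must [v] itself supply [k]. *)
Lemma good_segments k v h : word k v -> word k.+1 h ->
  (k \in v) || (k.+1 \in h) -> all (good k) (segments k v h).
Proof.
elim: h v => [|a h IH] v Wv; first by rewrite /= orbF /good Wv => _ ->.
move=> /andP[/= ak Wh]; case: eqP => [_ _|/eqP a_neq kh] /=.
  rewrite good_nseq IH ?mem_head //= ?leqnn //.
  by rewrite /good /word all_cat -/(word k v) Wv mem_cat mem_head orbT /= leqnn.
apply: IH => //; first by rewrite /word all_cat -/(word k v) Wv /=; lia.
move: kh; rewrite inE mem_cat eq_sym (negPf a_neq) /= => /orP[->|->] //.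
by rewrite orbT.
Qed.

Lemma act_pyramid k a w0 w1 w2 : a <= k -> word k w0 -> word k w2 ->
  act k.+1 a (w0 ++ map S w1 ++ w2) = act k a.-1 w0 ++ act k a w1 ++ act k a.-1 w2.
Proof.
move=> ak W0 W2; rewrite /act !map_cat -map_comp; congr (_ ++ (_ ++ _)).
- by apply/eq_in_map => x /(allP W0) /= xk; lia.
- by apply: eq_map => x /=; lia.
- by apply/eq_in_map => x /(allP W2) /= xk; lia.
Qed.

(** Each letter uses three words of [W]. A full pyramid closes a segment with [w0], puts [w1] at an
    odd place, where it is lifted, and opens a segment with [w2]; any other is absorbed by
    [act_pyramid]. *)
Lemma lift_odd_segments k n W v h : all (word k) W -> word k.+1 h ->
  size v + 3 * size h <= size W -> size h <= n ->
  flatten (lift_odd false (subs k W (segments k v h))) =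
  sub k W v ++ sub k.+1 (pyramids n (drop (size v) W)) h.
Proof.
elim: h v n W => [|a h IH] v n W WW; first by rewrite /= sub_nil.
move=> /andP[/= ak Wh] sW; case: n => // n; rewrite ltnS => hn.
have : all (word k) (drop (size v) W) by apply: all_drop.
have : 3 * (size h).+1 <= size (drop (size v) W) by rewrite size_drop; lia.
case E : (drop (size v) W) => [|w0 [|w1 [|w2 W']]] //=; try lia.
have D j : drop (size v + j) W = drop j (drop (size v) W) by rewrite drop_drop addnC.
move: D; rewrite E => D sW' /and4P[W0 W1 W2 WW']; case: eqP => [->|/eqP a_neq] /=.
  rewrite sub_cat E size_cat D /= ?sub_nil ?act_id ?cats0 (IH _ n) //=; [|by rewrite W2|lia].
  by rewrite drop0 sub_nil !act_id cats0 -!catA.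
rewrite (IH _ n) //; last by rewrite size_cat /=; lia.
rewrite sub_cat E size_cat D act_pyramid //=; last by move: a_neq ak; lia.
by rewrite sub_nil cats0 drop0 -!catA.
Qed.

Lemma base_pyramids k m M n W : 3 * M <= m -> base k m n W -> base k.+1 M n (pyramids M W).
Proof.
move=> Mm [sW]; rewrite -{}sW {m} in Mm *; move: Mm.
elim: M n W => // M IH n [|w0 [|w1 [|w2 W]]] /=; try by move=> MW; lia.
rewrite !size_cat => MW fn /and4P[/good_word W0 G1 /good_word W2 GW].
have [|||sP fP gP] := IH (n - (size w0 + size w1 + size w2)) W; rewrite ?GW //; try lia.
split=> /=; rewrite ?sP ?size_cat ?size_map //; first lia.
rewrite gP andbT /good /word !all_cat !mem_cat all_map mem_map; last exact: succn_inj.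
have [W1 ->] := andP G1; rewrite orbT andbT.
by apply/and3P; split; [move: W0|move: W1|move: W2]; apply: sub_all => x /= ?; lia.
Qed.

(** A letter [K] of [h] keeps its whole block of [q] letters [K]; a smaller letter leaves none. *)
Lemma FS_count K p h : word K h ->
  FS p (count_mem K (sub K [seq nseq q K | q <- p] h)).
Proof.
elim: p h => [|q p IH] [|a h]; try by move=> _; exact: FS0.
move=> /andP[/= aK /IH [s sp sE]]; rewrite count_cat -sE /act map_nseq count_nseq /= subKn //.
case: eqP => _; last by exists s; rewrite ?(subseq_trans sp (subseq_cons _ _)).
by exists (q :: s); rewrite /= ?eqxx ?mul1n.
Qed.

Lemma base_nseqs k m M p : pos p -> size p = m -> sumn p <= M ->
  base k m M [seq nseq q k | q <- p].
Proof.
move=> Pp sp pM; split; first by rewrite size_map.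
  rewrite size_flatten /shape -map_comp (@eq_map _ _ _ id) ?map_id // => q.
  by rewrite /= size_nseq.
rewrite all_map; apply: sub_all Pp => q q0.
by rewrite /good /word /= all_nseq mem_nseq q0 eqxx /= leqnn orbT.
Qed.

Lemma milliken_gowers k : (forall d, milliken k d) -> gowers k.+1.
Proof.
move=> Mk C m; have [M MP] := folkman m C.
(* [M] pyramids use [3 * M] words and give at most [2 * M + 1] segments; the extra [2 * M + 1] is
   room for padding. *)
have [n nP] := Mk (2 * M).+1 {ffun 'I_M.+1 -> C} (3 * M + (2 * M).+1).
exists n => c.
pose e t := c (flatten (lift_odd false t)).
(* Recording the colours of all odd prefixes lets one tuple length serve every number of full
   pyramids. *)
have [W [bW WP]] := nP (fun t => [ffun p : 'I_M.+1 => e (take (2 * p).+1 t)]).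
have [sW fW gW] := bW.
pose f p := e (take (2 * p).+1 (subs k W (nseq (2 * M).+1 [:: k]))).
pose Y := pyramids M W.
have bY : base k.+1 M n Y by apply: base_pyramids bW; lia.
have YP h : good k.+1 h -> size h <= M -> c (sub k.+1 Y h) = f (count_mem k.+1 h).
  move=> /andP[Wh kh] hM; have pM : count_mem k.+1 h <= M := leq_trans (count_size _ _) hM.
  have := @lift_odd_segments k M W [::] h (good_words gW) Wh.
  rewrite sub_nil drop0 => /= <- //; last lia.
  pose H := segments k [::] h ++ nseq (2 * M - 2 * count_mem k.+1 h) [:: k].
  have [_ gN fN] := tuple_in_nseq k (2 * M - 2 * count_mem k.+1 h).
  have tH : tuple_in k (2 * M).+1 (3 * M + (2 * M).+1) H.
    split; first by rewrite size_cat size_segments size_nseq; lia.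
      by rewrite all_cat good_segments.
    rewrite flatten_cat size_cat size_flatten_segments add0n leq_add //; first lia.
    by apply: leq_trans fN _; lia.
  have tN : tuple_in k (2 * M).+1 (3 * M + (2 * M).+1) (nseq (2 * M).+1 [:: k]).
    by have [? ? ?] := tuple_in_nseq k (2 * M).+1; split=> //; lia.
  move: (WP H _ tH tN) => /ffunP /(_ (Ordinal (pM : _ < M.+1))).
  rewrite !ffunE /= -/(f _) => <-; congr (e _).
  by rewrite subs_cat take_size_cat // size_subs size_segments.
have [p [x [Pp sp pM px]]] := MP f.
(* The block for [q] joins [q] full pyramids, so the number of full pyramids in a member is a subset
   sum of [p]. *)
have bP := base_nseqs k.+1 Pp sp pM; have [sP fP gP] := bP.
exists (subs k.+1 Y [seq nseq q k.+1 | q <- p]); split; first exact: subs_base bY bP.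
have [_ _ gY] := bY.
suff E h : good k.+1 h -> size h <= m ->
    c (sub k.+1 (subs k.+1 Y [seq nseq q k.+1 | q <- p]) h) = x.
  by move=> h h' gh gh' hm hm'; rewrite !E.
move=> gh hm; rewrite sub_subs ?good_words //.
have gPh : good k.+1 (sub k.+1 [seq nseq q k.+1 | q <- p] h) by rewrite good_sub ?sP.
rewrite YP //; last first.
  apply: leq_trans fP; rewrite size_sub -[in leqRHS](cat_take_drop (size h) (map _ p)).
  by rewrite flatten_cat size_cat leq_addr.
have [s sp' sE] := FS_count p (good_word gh).
rewrite -sE px // sE -has_count has_pred1.
by case/andP: gPh.
Qed.

Lemma gowers_all k : gowers k.
Proof.
elim: k => [|k Gk]; first exact: gowers0.
by apply: milliken_gowers => d; apply: gowers_milliken.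
Qed.

(** * Back from words to functions *)

Definition place (F : seq (seq nat)) (j x : nat) : nat :=
  if reshape_index (shape F) x == j
  then nth 0 (nth [::] F j) (reshape_offset (shape F) x) else 0.

Lemma place_flatten F x : place F (reshape_index (shape F) x) x = nth 0 (flatten F) x.
Proof. by rewrite /place eqxx nth_flatten. Qed.

(** [act] keeps lengths, so [sub k F h] has its blocks where [flatten F] has them. *)
Lemma nth_sub k F h x : size h = size F ->
  nth 0 (sub k F h) x =
  place F (reshape_index (shape F) x) x - (k - nth 0 h (reshape_index (shape F) x)).
Proof.
move=> sh; pose G := [seq act k p.2 p.1 | p <- zip F h].
have -> : sub k F h = flatten G.
  by rewrite /G; elim: F h sh {G} => [|f F IH] [|a h] //= [/IH ->].
have sG : shape G = shape F.
  by rewrite /G; elim: F h sh {G} => [|f F IH] [|a h] //= [/IH ->]; rewrite size_act.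
rewrite nth_flatten sG /place eqxx.
set j := reshape_index _ _; set c := reshape_offset _ _.
have [jF|Fj] := ltnP j (size F); last first.
  by rewrite !(nth_default [::]) ?nth_nil // /G size_map size_zip sh minnn.
rewrite /G (nth_map ([::], 0)) ?size_zip ?sh ?minnn // nth_zip //=.
have [cj|jc] := ltnP c (size (nth [::] F j)); first by rewrite (nth_map 0).
by rewrite (nth_default _ jc) sub0n nth_default ?size_act.
Qed.

Lemma place_supp F j x : place F j x != 0 -> reshape_index (shape F) x = j.
Proof. by rewrite /place; case: (_ =P j). Qed.

Lemma place_lt F j x : place F j x != 0 -> x < size (flatten F).
Proof.
move=> nz; have := nz; rewrite -(place_supp nz) place_flatten.
by apply: contraR; rewrite -leqNgt => /(nth_default 0) ->.
Qed.

Lemma block_place m F : block_seq (fun i : 'I_m => place F i).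
Proof.
move=> i j ij x y /place_supp xi /place_supp yj.
rewrite ltnNge (reshape_leq (shape F)) xi yj negb_or -leqNgt (ltnW ij) /=.
by rewrite gtn_eqF.
Qed.

Lemma FIN_place k m n F (i : 'I_m) : base k m n F -> FIN_below k n (place F i).
Proof.
move=> [sF fF gF]; have iF : i < size F by rewrite sF.
have /andP[/allP Wi ki] : good k (nth [::] F i) by apply: (allP gF); rewrite mem_nth.
have lt x : supp (place F i) x -> x < n.
  by move=> /place_lt /leq_trans; apply.
split=> //; split.
- move=> x; rewrite /place; case: eqP => // _.
  set c := reshape_offset _ _; have [cj|jc] := ltnP c (size (nth [::] F i)).
    exact/Wi/mem_nth.
  by rewrite nth_default.
- have ci : index k (nth [::] F i) < nth 0 (shape F) i.
    by rewrite (nth_map [::]) // index_mem.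
  exists (flatten_index (shape F) i (index k (nth [::] F i))).
  by rewrite /place flatten_indexKl // eqxx flatten_indexKr // nth_index.
- by apply: sub_finite_set (finite_II n) => x /lt.
Qed.

Lemma comb_space_place k m n F g : base k m n F ->
  comb_space (fun i : 'I_m => place F i) g ->
  exists h, [/\ good k h, size h = m & g = nth 0 (sub k F h)].
Proof.
move=> bF [p [i [l [_ imono [a0 la0] ->]]]].
have iinj a b : i a = i b -> a = b.
  move=> e; have [/imono|/imono|/val_inj //] := ltngtP a b; by rewrite e ltnn.
(* A block missing from the sum gets the letter 0, which erases it; the exponent 0 at [a0] yields
   the letter [k]. *)
pose lev (j : 'I_m) := if [pick a | i a == j] is Some a then k - l a else 0.
have levE a : lev (i a) = k - l a.
  by rewrite /lev; case: pickP => [b /eqP /iinj -> //|/(_ a)]; rewrite eqxx.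
exists [seq lev j | j <- enum 'I_m]; have [sF fF gF] := bF; split.
- apply/andP; split.
    apply/allP => _ /mapP[j _ ->] /=; rewrite /lev; case: pickP => // a _; exact: leq_subr.
  by apply/mapP; exists (i a0); rewrite ?mem_enum // levE la0 subn0.
- by rewrite size_map size_enum_ord.
- apply/funext => x; rewrite nth_sub; last by rewrite size_map size_enum_ord.
set j := reshape_index _ _.
under eq_bigr => a _ do rewrite iter_tetrisE.
have z a : i a <> j :> nat -> place F (i a) x - l a = 0.
  by move=> ne; rewrite /place -/j; case: eqP => // e; case: ne.
have [jm|mj] := ltnP j m; last first.
  rewrite big1 => [|a _]; last by apply: z => e; have := ltn_ord (i a); rewrite e ltnNge mj.
  rewrite place_flatten nth_default ?sub0n // leqNgt size_flatten.
  by apply: contraTN mj => /reshape_indexP; rewrite -ltnNge size_map sF.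
have xk : place F j x <= k by case: (FIN_place (Ordinal jm) bF) => -[].
rewrite (nth_map (Ordinal jm)) ?size_enum_ord // (_ : nth _ _ _ = Ordinal jm); last first.
  by apply: val_inj; rewrite /= nth_enum_ord.
rewrite /lev; case: pickP => [a /eqP ia|none].
  rewrite (bigD1 a) //= big1 => [|b ba]; last first.
    by apply: z => e; case/eqP: ba; apply: iinj; rewrite ia; apply: val_inj.
  by rewrite ia /=; lia.
rewrite big1 => [|a _]; first by apply/esym/eqP; rewrite subn0 subn_eq0.
by apply: z => e; have /eqP[] := none a; apply: val_inj.
Qed.

Theorem theorem1 (m k r : nat) (hk : 1 <= k) :
  exists n : nat, forall c : FIN_below k n -> 'I_r,
    exists f : 'I_m -> nat -> nat,
      [/\ forall i, FIN_below k n (f i),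
          block_seq f
        & forall g h : FIN_below k n,
            comb_space f (val g) -> comb_space f (val h) -> c g = c h].
Proof.
case: r => [|r].
  (* There is no colouring with zero colours once [FIN_below k n] is inhabited, which [n = 1]
     ensures. *)
  exists 1 => c.
  have F1 : FIN_below k 1 (fun x => if x == 0 then k else 0).
    have lt x : supp (fun x => if x == 0 then k else 0) x -> x < 1.
      by rewrite /supp /=; case: x.
    split=> //; split=> [x|| ]; first by case: ifP.
      by exists 0.
    by apply: sub_finite_set (finite_II 1) => x /lt.
  by case: (c (SigSub (mem_set F1))).
have [n nP] := gowers_all k 'I_r.+1 m; exists n => c.
(* The default [ord0] colours words outside [FIN_below k n]; by [dE] it never occurs on the
   space. *)
pose d (w : seq nat) := oapp c ord0 (insub (nth 0 w)).
have [F [bF FP]] := nP d.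
exists (fun i => place F i); split.
- by move=> i; apply: FIN_place bF.
- exact: block_place.
have dE g w : val g = nth 0 w -> d w = c g by move=> gw; rewrite /d -gw valK.
move=> g h /(comb_space_place bF)[u [gu su /dE <-]] /(comb_space_place bF)[v [gv sv /dE <-]].
by apply: FP; rewrite ?su ?sv.
Qed.
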